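(* Let $n\geq 1$, let $\Sigma_n$ denote the permutation group on $n$ letters, and let $\Sigma_n$ act on $M_{n,n}(\mathbb{R}_{\geqslant})$ by permuting columns: $$(\sigma,(A_1,\ldots,A_n))\longmapsto (A_{\sigma^{-1}(1)},\ldots,A_{\sigma^{-1}(n)}),$$ where $A=(A_1,\ldots,A_n)$ is written in terms of its columns. Then the set $O(n)^{\mathrm{trop}}$ of tropical orthogonal $n\times n$ matrices is equal to the orbit of the identity matrix under this action $\Sigma_n\times M_{n,n}(\mathbb{R}_{\geqslant})\to M_{n,n}(\mathbb{R}_{\geqslant})$.
   Context: $\mathbb{R}_{\geqslant}=[0,\infty)$ is the set of nonnegative real numbers, and $M_{n,n}(\mathbb{R}_{\geqslant})$ is the set of $n\times n$ matrices with entries in $\mathbb{R}_{\geqslant}$. For $v=(v_1,\ldots,v_n)$ and $w=(w_1,\ldots,w_n)$ in $\mathbb{R}_{\geqslant}^n$ the tropical inner product is $\langle v,w\rangle_{\mathrm{trop}}=\max\{v_iw_i : 1\leq i\leq n\}$ (usual products of real numbers), and the tropical norm is $\|v\|_{\mathrm{trop}}=(\max\{v_i^2:1\leq i\leq n\})^{1/2}$. $O(n)^{\mathrm{trop}}$ is the set of all matrices $A=(A_1,\ldots,A_n)\in M_{n,n}(\mathbb{R}_{\geqslant})$ (with columns $A_i$) such that $\|A_i\|_{\mathrm{trop}}=1$ for all $i$ and $\langle A_i,A_j\rangle_{\mathrm{trop}}=0$ for all $i\neq j$. *)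

(* Defs.v *)
From HB Require Import structures.
From mathcomp Require Import all_boot all_order all_algebra all_fingroup.
From mathcomp Require Import classical_sets reals interval_inference.

Set Implicit Arguments.
Unset Strict Implicit.
Unset Printing Implicit Defensive.

Import Order.TTheory GRing.Theory Num.Theory.
Local Open Scope ring_scope.
Local Open Scope classical_set_scope.

(* The maxima below range over nonnegative reals, so the default value 0 of
   the big operator does not affect them when n > 0. *)
Definition trop_inner (R : realType) (n : nat) (v w : 'cV[{nonneg R}]_n) : R :=
  \big[Num.max/0]_(i < n) ((v i ord0)%:num * (w i ord0)%:num).

Definition trop_norm (R : realType) (n : nat) (v : 'cV[{nonneg R}]_n) : R :=
  Num.sqrt (\big[Num.max/0]_(i < n) ((v i ord0)%:num ^+ 2)).

Definition trop_orthogonal (R : realType) (n : nat) : set 'M[{nonneg R}]_n :=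
  [set A | (forall i, trop_norm (col i A) = 1) /\
           (forall i j, i != j -> trop_inner (col i A) (col j A) = 0)].

Arguments trop_orthogonal R n : clear implicits.

(* {nonneg R} carries no semiring structure, so 1%:M is not available. *)
Definition nng_id_mx (R : realType) (n : nat) : 'M[{nonneg R}]_n :=
  \matrix_(i, j) NngNum (ler0n R (i == j)).

(* Column j of [col_permute A s] is column s^-1(j) of A. *)
Definition col_permute (T : Type) (n : nat) (A : 'M[T]_n) (s : 'S_n) : 'M[T]_n :=
  \matrix_(i, j) A i ((s^-1)%g j).

(* Permutations compose left to right in MathComp, (s * t) x = t (s x), so the
   left action of the permutation group is a MathComp (right) action. *)
Lemma col_permute1 (T : Type) (n : nat) (A : 'M[T]_n) : col_permute A 1%g = A.
Proof. by apply/matrixP=> i j; rewrite mxE invg1 perm1. Qed.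

Lemma col_permuteM (T : Type) (n : nat) (A : 'M[T]_n) (s t : 'S_n) :
  col_permute A (s * t)%g = col_permute (col_permute A s) t.
Proof. by apply/matrixP=> i j; rewrite !mxE invMg permM. Qed.

Definition col_action (T : Type) (n : nat) : {action 'S_n &-> 'M[T]_n} :=
  TotalAction (@col_permute1 T n) (@col_permuteM T n).

(* The library's [orbit] requires the set acted upon to be a finType. *)
Definition act_orbit (aT : finGroupType) (T : Type) (to : {action aT &-> T})
  (x : T) : set T := [set to x a | a in [set: aT]].

Arguments col_action T n : clear implicits.

(* Main.v *)
(* Each column of a tropical orthogonal matrix contains an entry 1, say in row
   f j. Orthogonality makes f injective, hence a permutation, so every row k
   contains an entry 1, in column f^-1 k; orthogonality with that column kills
   all the other entries of row k. *)
Require Import Defs.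
From mathcomp Require Import all_boot all_order all_algebra all_fingroup.
From mathcomp Require Import classical_sets reals interval_inference.
Import Order.TTheory GRing.Theory Num.Theory.
Local Open Scope ring_scope.
Local Open Scope classical_set_scope.

Lemma trop_inner_eq0P (R : realType) (n : nat) (v w : 'cV[{nonneg R}]_n) :
  trop_inner v w = 0 <->
  forall i, (v i ord0)%:num * (w i ord0)%:num = 0 :> R.
Proof.
split=> [vw0 i|vw0]; last by rewrite /trop_inner big1_idem //= maxxx.
apply/eqP; rewrite eq_le mulr_ge0 // andbT -vw0.
exact: (le_bigmax _ (fun i => (v i ord0)%:num * (w i ord0)%:num)).
Qed.

(** On nonnegative numbers squaring preserves order and only 1 has square 1, so the norm is 1
    exactly when the largest entry is 1. *)
Lemma trop_norm_eq1P (R : realType) (n : nat) (v : 'cV[{nonneg R}]_n) :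
  trop_norm v = 1 <->
  (exists i, (v i ord0)%:num = 1 :> R) /\ forall i, (v i ord0)%:num <= 1 :> R.
Proof.
pose F i : R := (v i ord0)%:num ^+ 2.
have leF i : F i <= \big[Num.max/0]_(i < n) F i by exact: le_bigmax.
have sqr1 (x : {nonneg R}) : (x%:num ^+ 2 = 1 :> R) -> x%:num = 1 :> R.
  by move=> /eqP; rewrite sqrp_eq1 // => /eqP.
split=> [v1|[[i vi1] v_le1]].
  have max1 : \big[Num.max/0]_(i < n) F i = 1.
    have max_ge0 : 0 <= \big[Num.max/0]_(i < n) F i by exact: bigmax_ge_id.
    by rewrite -[LHS]sqr_sqrtr // -/(trop_norm v) v1 expr1n.
  split=> [|i]; last by rewrite -(@expr_le1 _ 2) // -max1 leF.
  have [i Fi1|noF] := pickP (fun i => F i == 1).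
    by exists i; apply: sqr1; apply/eqP.
  (* If no square equals 1, all of them and the default value 0 lie below 1, hence so does the
     maximum; this also rules out [n = 0]. *)
  have : \big[Num.max/0]_(i < n) F i < 1.
    apply: bigmax_lt => // i _.
    by rewrite lt_neqAle noF /= -max1 leF.
  by rewrite max1 ltxx.
rewrite /trop_norm (_ : \big[_/_]_(_ < _) _ = 1) ?sqrtr1 //.
apply: le_anti; apply/andP; split.
  by apply: bigmax_le => // j _; rewrite expr_le1.
by rewrite -[leLHS](expr1n _ 2) -vi1 leF.
Qed.

Theorem lemma2p20 (R : realType) (n : nat) (hn : (0 < n)%N) :
  trop_orthogonal R n = act_orbit (col_action {nonneg R} n) (nng_id_mx R n).
Proof.
apply/seteqP; split=> [A [normA innerA]|_ [s _ <-]].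
  have has1 j : exists i, (A i j)%:num == 1 :> R.
    have /trop_norm_eq1P[[i]] := normA j.
    by rewrite mxE => Aij1 _; exists i; apply/eqP.
  pose f j := xchoose (has1 j).
  have Af1 j : (A (f j) j)%:num = 1 :> R by apply/eqP/(xchooseP (has1 j)).
  have A_eq0 j k : j != k -> (A (f j) k)%:num = 0 :> R.
    move=> /innerA/trop_inner_eq0P/(_ (f j)).
    by rewrite !mxE Af1 mul1r.
  have f_inj : injective f.
    move=> j k fjk; apply/eqP; apply/negPn/negP => /A_eq0/eqP.
    by rewrite fjk Af1 oner_eq0.
  (* The action places column [s^-1 j] at position [j], and column [j] of [A] has its 1 in row
     [f j], so [s] is the inverse of [f]. *)
  exists (perm f_inj)^-1%g => //.
  apply/matrixP=> i j; rewrite !mxE invgK permE; apply/val_inj => /=.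
  (* Row [i] is written as [f k]; its entry in column [j] is then 1 or 0 according to whether
     [k = j]. *)
  rewrite -[i](permKV (perm f_inj)) permE (inj_eq f_inj).
  by case: eqVneq => [->|/A_eq0->]; rewrite ?Af1.
split=> [j|j k jk].
  apply/trop_norm_eq1P; split=> [|i].
    by exists (s^-1%g j); rewrite !mxE /= eqxx.
  by rewrite !mxE /= lern1 leq_b1.
(* Both factors are 0 or 1, and both are 1 only if [i] is at once [s^-1 j] and [s^-1 k]. *)
apply/trop_inner_eq0P => i; rewrite !mxE /= -natrM mulnb.
case: (eqVneq i (s^-1%g j)) => //= ->.
by rewrite (inj_eq perm_inj) (negbTE jk).
Qed.
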